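(* Let $E$ be a complete $\mathbb{C}$-normable space and $X\subset E$ a convex open subset, and let $f:X\to\mathbb{R}$ be a continuous function. If $f$ is convex, then $f$ is plurisubharmonic, and if $f$ is strictly convex, then $f$ is strictly plurisubharmonic.
   Context: A normable space is a topological vector space whose topology can be defined by a norm. A continuous function $f:X\to\mathbb{R}$ on a convex subset $X$ of a topological real affine space $F$ is convex if for all (real) affine maps $\gamma:[-1,1]\to F$ with values in $X$, $f(\gamma(0))\leq\frac{f(\gamma(-1))+f(\gamma(1))}{2}$; it is strictly convex if moreover this inequality is strict whenever $\gamma$ is non-constant. (Here $E$ is regarded as a real space.) Let $\bar{\mathbb{D}}\subset\mathbb{C}$ be the closed unit disc. A map defined on $\bar{\mathbb{D}}$ is holomorphic if it extends to a holomorphic map on a neighbourhood of $\bar{\mathbb{D}}$. An upper semicontinuous function $f:X\to\mathbb{R}\cup\{-\infty\}$ on a holomorphic manifold $X$ (for instance an open subset of a complete $\mathbb{C}$-normable space) is plurisubharmonic if for all holomorphic maps $\gamma:\bar{\mathbb{D}}\to X$, $f(\gamma(0))\leq\frac{1}{2\pi}\int_0^{2\pi}f(\gamma(e^{it}))\,dt$; it is strictly plurisubharmonic if moreover this inequality is strict whenever $\gamma$ is non-constant. *)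

(* Defs.v *)
From mathcomp Require Import all_boot all_order all_algebra.
From mathcomp Require Import complex.
From mathcomp Require Import all_classical all_reals all_analysis.

Set Implicit Arguments.
Unset Strict Implicit.
Unset Printing Implicit Defensive.

Import Order.TTheory GRing.Theory Num.Theory numFieldNormedType.Exports.

Local Open Scope classical_set_scope.
Local Open Scope ring_scope.
Local Open Scope complex_scope.

(* A complete C-normable space is represented by [E : completeNormedModType
   R[i]]: a norm defining the topology is chosen, but the definitions below
   depend on it only through the topology of [E].  Functions on a subset [X]
   of [E] are represented by total functions on [E], of which only the values
   on [X] are used. *)

Section ConvexFunctions.
Context {R : realType} {E : normedModType R[i]}.
Implicit Types (X : set E) (f : E -> R).

(* [a] is only used on [-1, 1]; [E] is regarded as a real vector space through
   the embedding [k |-> k%:C] of the reals into the complex numbers. *)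
Definition affine_segment (a : R -> E) : Prop :=
  forall s t k : R, s \in `[-1, 1] -> t \in `[-1, 1] -> k \in `[0, 1] ->
    a (k * s + (1 - k) * t) = k%:C *: a s + (1 - k)%:C *: a t.

Definition convex_on X f : Prop :=
  forall a : R -> E, affine_segment a -> (forall t, t \in `[-1, 1] -> X (a t)) ->
    f (a 0) <= (f (a (-1)) + f (a 1)) / 2.

Definition strictly_convex_on X f : Prop :=
  convex_on X f /\
  forall a : R -> E, affine_segment a -> (forall t, t \in `[-1, 1] -> X (a t)) ->
    (exists s t : R, [/\ s \in `[-1, 1], t \in `[-1, 1] & a s <> a t]) ->
    f (a 0) < (f (a (-1)) + f (a 1)) / 2.

End ConvexFunctions.

Section PlurisubharmonicFunctions.
Context {R : realType} {E : normedModType R[i]}.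
Implicit Types (X : set E) (f : E -> \bar R).

Definition closed_unit_disc : set R[i]^o := [set z | `|z| <= 1].

(* e^{it} *)
Definition circle_point (t : R) : R[i]^o := cos t +i* sin t.

(* [derivable g z 1] is the existence of the limit of
   h^-1 *: (g (z + h) - g z) as the complex number h tends to 0. *)
Definition holomorphic_on (U : set R[i]^o) (g : R[i]^o -> E) : Prop :=
  open U /\ forall z, U z -> derivable g z 1.

(* Only the values of [c] on the closed unit disc matter. *)
Definition holomorphic_disc X (c : R[i]^o -> E) : Prop :=
  exists (U : set R[i]^o) (g : R[i]^o -> E),
    [/\ closed_unit_disc `<=` U,
        holomorphic_on U g,
        forall z, U z -> X (g z) &
        forall z, closed_unit_disc z -> g z = c z].

Definition upper_semicontinuous_on X f : Prop :=
  forall (x : E) (r : R), X x -> (f x < r%:E)%E ->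
    \forall y \near within X (nbhs x), (f y < r%:E)%E.

Definition circle_mean f (c : R[i]^o -> E) : \bar R :=
  (((2 * pi)^-1)%:E *
    \int[lebesgue_measure]_(t in `[0%R, (2 * pi)%R]) f (c (circle_point t)))%E.

(* Plurisubharmonic functions take values in R U {-oo}: the value +oo is
   excluded explicitly. *)
Definition plurisubharmonic_on X f : Prop :=
  [/\ forall x, X x -> f x <> +oo%E,
      upper_semicontinuous_on X f &
      forall c : R[i]^o -> E, holomorphic_disc X c ->
        (f (c 0%R) <= circle_mean f c)%E].

Definition strictly_plurisubharmonic_on X f : Prop :=
  plurisubharmonic_on X f /\
  forall c : R[i]^o -> E, holomorphic_disc X c ->
    (exists z w, [/\ closed_unit_disc z, closed_unit_disc w & c z <> c w]) ->
    (f (c 0%R) < circle_mean f c)%E.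

End PlurisubharmonicFunctions.

(* Main.v *)
(* For g holomorphic near the closed unit disc, the average M_m of g(e^{it}) over
   the midpoints t of the 2^m equal parts of [0, 2 pi] tends to g(0): this is
   Goursat's theorem for w |-> g(e^w) on a rectangle [-N, 0] x [0, 2 pi], proved
   directly on Riemann sums, so that no vector-valued integral is needed.
   Midpoint convexity of f gives f(M_m) <= average of f o g, whence f(g(0)) is at
   most the mean of f o g by continuity.  If f is strictly convex, this inequality
   for (g + g(0)) / 2 yields the strict one for g, unless g = g(0) on the whole
   circle; in that case, the inequality for the convex function |x - g(0)| and g
   composed with the Moebius maps of the disc shows that g is constant. *)
Require Import Defs.
From mathcomp Require Import all_boot all_order all_algebra.
From mathcomp Require Import complex ring lra.
From mathcomp Require Import all_classical all_reals all_analysis.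
Import Order.TTheory GRing.Theory Num.Theory numFieldNormedType.Exports.

Local Open Scope classical_set_scope.
Local Open Scope ring_scope.
Local Open Scope complex_scope.

(** * The norm of a complex normed space as a real number *)

Section RealNorm.
Context {R : realType} {E : normedModType R[i]}.
Implicit Types (x y z : E) (k : R).

(** Norms over [R[i]] are complex numbers; the real part loses nothing, by [rnormE], and makes real
    inequalities and [lra] available. *)
Definition rnorm x : R := complex.Re `|x|.

Lemma rnormE x : (rnorm x)%:C = `|x|.
Proof. by apply: RRe_real; rewrite normr_real. Qed.

Lemma rnorm_ge0 x : 0 <= rnorm x.
Proof. by rewrite -lecR rnormE normr_ge0. Qed.

Lemma rnorm0 : rnorm (0 : E) = 0.
Proof. by rewrite /rnorm normr0. Qed.

Lemma rnorm0_eq0 x : rnorm x = 0 -> x = 0.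
Proof. by move=> x0; apply/normr0_eq0; rewrite -rnormE x0. Qed.

Lemma rnormN x : rnorm (- x) = rnorm x.
Proof. by rewrite /rnorm normrN. Qed.

Lemma rnormB x y : rnorm (x - y) = rnorm (y - x).
Proof. by rewrite -rnormN opprB. Qed.

Lemma ler_rnormD x y : rnorm (x + y) <= rnorm x + rnorm y.
Proof. by rewrite -lecR rmorphD /= !rnormE ler_normD. Qed.

Lemma ler_rnormB x y : rnorm (x - y) <= rnorm x + rnorm y.
Proof. by rewrite -(rnormN y) ler_rnormD. Qed.

Lemma ler_rnorm_dist x y z : rnorm (x - z) <= rnorm (x - y) + rnorm (y - z).
Proof. by rewrite -(subrKA y) ler_rnormD. Qed.

Lemma rnormZ (a : R[i]) x : rnorm (a *: x) = complex.Re `|a| * rnorm x.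
Proof.
apply: complexI; rewrite rmorphM /= !rnormE normrZ; congr (_ * _).
Qed.

Lemma normcR k : complex.Re `|k%:C| = `|k|.
Proof. by rewrite normc_def /= expr0n addr0 sqrtr_sqr. Qed.

Lemma rnormZr k x : rnorm (k%:C *: x) = `|k| * rnorm x.
Proof. by rewrite rnormZ normcR. Qed.

Lemma rnormZi x : rnorm ('i *: x) = rnorm x.
Proof. by rewrite rnormZ normc_def /= expr0n expr1n add0r sqrtr1 mul1r. Qed.

(** Positive elements of [R[i]] are real, so balls of real radius already form a base of
    neighbourhoods. *)
Lemma nbhs_rnormP (P : set E) x :
  nbhs x P <-> exists2 e : R, 0 < e & forall y, rnorm (y - x) < e -> P y.
Proof.
split.
  move=> /nbhs_normP [e /= e0 xe].
  have eR : (complex.Re e)%:C = e by apply/RRe_real/gtr0_real.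
  exists (complex.Re e); first by rewrite -ltcR eR.
  move=> y; rewrite -ltcR rnormE eR => ye; apply: xe.
  by rewrite /= distrC.
move=> [e e0 xe]; apply/nbhs_normP; exists e%:C => /=; first by rewrite ltcR.
by move=> y /= ye; apply: xe; rewrite -ltcR rnormE distrC.
Qed.

End RealNorm.

(** * Averages over dyadic midpoints *)

Section DyadicMean.
Context {R : realType} {K : numFieldType} {V : lmodType K}.
Implicit Types (g h : R -> V) (a b : R).

(** Halving the interval instead of summing over an index makes level [m.+1] the mean of level [m]
    on the two halves by definition, as the subdivision arguments require. *)
Fixpoint dyadic_mean (m : nat) g a b : V :=
  if m is m'.+1 then
    2^-1 *: (dyadic_mean m' g a ((a + b) / 2) + dyadic_mean m' g ((a + b) / 2) b)
  else g ((a + b) / 2).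

Lemma dyadic_meanD m g h a b :
  dyadic_mean m (fun t => g t + h t) a b = dyadic_mean m g a b + dyadic_mean m h a b.
Proof.
elim: m a b => [//|m IH] a b /=.
by rewrite !IH addrACA scalerDr.
Qed.

Lemma dyadic_mean_affine m g a b :
  (forall s t, g ((s + t) / 2) = 2^-1 *: (g s + g t)) ->
  dyadic_mean m g a b = g ((a + b) / 2).
Proof.
move=> gP; elim: m a b => [//|m IH] a b /=.
by rewrite !IH -gP; congr g; lra.
Qed.

(** Each level takes one more midpoint, so stability under midpoints suffices; [A] will be a ball,
    an interval or a convex set. *)
Lemma dyadic_mean_in m (A : set V) g a b : a <= b ->
  (forall u v, A u -> A v -> A (2^-1 *: (u + v))) ->
  (forall t, a <= t <= b -> A (g t)) -> A (dyadic_mean m g a b).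
Proof.
move=> ab Amid; elim: m a b ab => [|m IH] a b ab gA /=; first by apply: gA; lra.
by apply: Amid; apply: IH; [lra|move=> t ht; apply: gA; lra|lra|
  move=> t ht; apply: gA; lra].
Qed.

End DyadicMean.

(** * Subdivision of rectangles and intervals *)

Section Cousin.
Context {R : realType}.
Implicit Types P : R -> R -> R -> R -> Prop.

(** If [P] failed, it would fail again on some quarter; the nested bad quarters would shrink to a
    point, near which the local hypothesis gives [P]. *)
Lemma cousin_rectangle P (a b c d : R) : a <= b -> c <= d ->
  (forall x1 x2 y1 y2, x1 <= x2 -> y1 <= y2 ->
     P x1 ((x1 + x2) / 2) y1 ((y1 + y2) / 2) ->
     P ((x1 + x2) / 2) x2 y1 ((y1 + y2) / 2) ->
     P x1 ((x1 + x2) / 2) ((y1 + y2) / 2) y2 ->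
     P ((x1 + x2) / 2) x2 ((y1 + y2) / 2) y2 ->
     P x1 x2 y1 y2) ->
  (forall p q, a <= p <= b -> c <= q <= d ->
     exists2 e, 0 < e &
       forall x1 x2 y1 y2, x1 <= p <= x2 -> y1 <= q <= y2 ->
         x2 - x1 < e -> y2 - y1 < e -> P x1 x2 y1 y2) ->
  P a b c d.
Proof.
move=> ab cd Pmerge Ploc; apply: contrapT => nP.
pose rect := (R * R * (R * R))%type.
pose Q (r : rect) := P r.1.1 r.1.2 r.2.1 r.2.2.
pose wf (r : rect) := r.1.1 <= r.1.2 /\ r.2.1 <= r.2.2.
pose sub (r s : rect) := [/\ r.1.1 <= s.1.1, s.1.2 <= r.1.2,
  r.2.1 <= s.2.1 & s.2.2 <= r.2.2].
pose half (r s : rect) := s.1.2 - s.1.1 = (r.1.2 - r.1.1) / 2 /\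
  s.2.2 - s.2.1 = (r.2.2 - r.2.1) / 2.
(* The hypotheses stand under the existential so that [choice] yields a total function; [r] itself
   is the default value. *)
have step (r : rect) : exists s : rect, wf r -> ~ Q r ->
    [/\ wf s, ~ Q s, sub r s & half r s].
  case: (pselect (wf r /\ ~ Q r)) => [[wr nQ]|h]; last first.
    by exists r => wr nQ; case: h.
  apply: contrapT => nex; apply: nQ.
  case: r wr nex => -[x1 x2] [y1 y2] [/= x12 y12] nex.
  have try s1 s2 t1 t2 : s1 <= s2 -> t1 <= t2 ->
      sub ((x1, x2), (y1, y2)) ((s1, s2), (t1, t2)) ->
      half ((x1, x2), (y1, y2)) ((s1, s2), (t1, t2)) -> P s1 s2 t1 t2.
    move=> s12 t12 su ha; apply: contrapT => nPs; apply: nex.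
    by exists ((s1, s2), (t1, t2)).
  by apply: Pmerge => //=; apply: try => //=; rewrite /sub /half /=;
    try (split; lra); lra.
have [next nextP] := choice step.
pose r n := iter n next ((a, b), (c, d)).
have rP n : wf (r n) /\ ~ Q (r n).
  elim: n => [|n [IH1 IH2]]; first by split.
  by have [] := nextP _ IH1 IH2.
have rS n : sub (r n) (r n.+1) /\ half (r n) (r n.+1).
  by have [] := nextP _ (rP n).1 (rP n).2.
have rsub n k : sub (r n) (r (k + n)%N).
  elim: k => [|k [h1 h2 h3 h4]]; first by rewrite /sub.
  have [[g1 g2 g3 g4] _] := rS (k + n)%N.
  by rewrite addSn; split; lra.
have rw n : (r n).1.2 - (r n).1.1 = (b - a) / 2 ^+ n /\
    (r n).2.2 - (r n).2.1 = (d - c) / 2 ^+ n.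
  elim: n => [|n [h1 h2]]; first by rewrite expr0 !divr1.
  have [_ [-> ->]] := rS n; rewrite h1 h2 exprS.
  by split; rewrite -mulrA -invfM [_ * 2]mulrC.
(* By nesting, it is enough to compare with the rectangle of larger index. *)
have comp (n k : nat) : (r n).1.1 <= (r k).1.2 /\ (r n).2.1 <= (r k).2.2.
  have [nk|/ltnW kn] := leqP n k.
    by have [] := rsub n (k - n)%N; rewrite subnK// => h1 h2 h3 h4;
      have [[]] := rP k => h5 h6 _; split; lra.
  by have [] := rsub k (n - k)%N; rewrite subnK// => h1 h2 h3 h4;
    have [[]] := rP n => h5 h6 _; split; lra.
(* The supremum of the left ends lies in all the intervals. *)
have squeeze (u v : nat -> R) : (forall n k, u n <= v k) ->
    exists p, forall n, u n <= p <= v n.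
  move=> uv; exists (sup (range u)) => n.
  have ub : has_ubound (range u) by exists (v 0%N) => _ [k _ <-].
  apply/andP; split; first by apply: ub_le_sup => //; exists n.
  by apply: ge_sup; [exists (u 0%N), 0%N|move=> _ [k _ <-]].
have [p pP] := squeeze _ _ (fun n k => (comp n k).1).
have [q qP] := squeeze _ _ (fun n k => (comp n k).2).
have [e e0 eP] := Ploc p q (pP 0%N) (qP 0%N).
have small (l : R) : 0 <= l -> exists N, forall n, (N <= n)%N -> l / 2 ^+ n < e.
  move=> l0; have : l / 2 ^+ n @[n --> \oo] --> (0 : R).
    rewrite -[X in _ --> X](mulr0 l); apply: cvgM; first exact: cvg_cst.
    under eq_fun do rewrite -exprVn.
    by apply: cvg_expr; rewrite ger0_norm; lra.
  move=> /cvgrPdist_lt /(_ _ e0) [N _ NP]; exists N => n Nn.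
  have := NP n Nn; rewrite sub0r normrN ger0_norm//.
  by rewrite divr_ge0// exprn_ge0.
have [|N NP] := small (b - a); first by lra.
have [|M MP] := small (d - c); first by lra.
pose n := maxn N M.
have [_] := rP n; apply; apply: eP; [exact: pP|exact: qP| |].
- by rewrite (rw n).1; apply: NP; rewrite leq_maxl.
- by rewrite (rw n).2; apply: MP; rewrite leq_maxr.
Qed.

Lemma cousin_itv (P : R -> R -> Prop) (a b : R) : a <= b ->
  (forall x y, x <= y -> P x ((x + y) / 2) -> P ((x + y) / 2) y -> P x y) ->
  (forall p, a <= p <= b -> exists2 e, 0 < e &
     forall x y, x <= p <= y -> y - x < e -> P x y) ->
  P a b.
Proof.
move=> ab Pmerge Ploc.
(* The second side of the rectangle is reduced to the point 0. *)
apply: (@cousin_rectangle (fun x y _ _ => P x y) a b 0 0) => //.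
- by move=> x1 x2 _ _ x12 _ h1 h2 _ _; exact: Pmerge.
- move=> p q /Ploc [e e0 eP] _; exists e => // x1 x2 _ _ hp _ h _.
  exact: eP.
Qed.

End Cousin.

Lemma half_complex {R : realType} : (2^-1 : R[i]) = (2^-1)%:C.
Proof. by rewrite fmorphV rmorph_nat. Qed.

(** * Goursat's theorem on Riemann sums *)

Section Goursat.
Context {R : realType} {E : normedModType R[i]}.
Implicit Types (g : R -> E) (G : R -> R -> E) (a b c d : R) (A : E).

Lemma rnorm_mid (u v : E) (k : R) : rnorm u <= k -> rnorm v <= k ->
  rnorm (2^-1 *: (u + v)) <= k.
Proof.
move=> uk vk; rewrite half_complex rnormZr ger0_norm//.
by have := ler_rnormD u v; lra.
Qed.

Lemma rnorm_dyadic_mean m g a b (k : R) : a <= b ->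
  (forall t, a <= t <= b -> rnorm (g t) <= k) -> rnorm (dyadic_mean m g a b) <= k.
Proof.
move=> ab gk.
exact: (@dyadic_mean_in R _ E m [set v | rnorm v <= k] g a b ab (fun u v => @rnorm_mid u v k)).
Qed.

(** The midpoint Riemann sum of [g] on $[a,b]$ with $2^m$ equal steps. *)
Definition side m g a b : E := (b - a)%:C *: dyadic_mean m g a b.

(** The factor 1/2 of the mean is absorbed by the halved lengths, so these sums are exactly
    additive. *)
Lemma sideS m g a b :
  side m.+1 g a b = side m g a ((a + b) / 2) + side m g ((a + b) / 2) b.
Proof.
rewrite /side /= scalerA half_complex -rmorphM scalerDr.
by congr (_%:C *: _ + _%:C *: _); lra.
Qed.

Lemma sideD m g h a b :
  side m (fun t => g t + h t) a b = side m g a b + side m h a b.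
Proof. by rewrite /side dyadic_meanD scalerDr. Qed.

Lemma rnorm_side m g a b (k : R) : a <= b ->
  (forall t, a <= t <= b -> rnorm (g t) <= k) -> rnorm (side m g a b) <= (b - a) * k.
Proof.
move=> ab gk; rewrite /side rnormZr ger0_norm ?subr_ge0//.
by apply: ler_wpM2l; [rewrite subr_ge0|exact: rnorm_dyadic_mean].
Qed.

(* Midpoint sums at level [m] of the integral of [G(x + iy) dw] along the
   positively oriented boundary of the rectangle [a, b] x [c, d]. *)
Definition contour m G a b c d : E :=
  'i *: (side m (G b) c d - side m (G a) c d) +
  (side m (G^~ c) a b - side m (G^~ d) a b).

(** Adjacent quarters sample their common side at the same points with opposite orientations, so the
    inner sides cancel exactly. *)
Lemma contourS m G a b c d :
  contour m.+1 G a b c d =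
    contour m G a ((a + b) / 2) c ((c + d) / 2) +
    contour m G ((a + b) / 2) b c ((c + d) / 2) +
    (contour m G a ((a + b) / 2) ((c + d) / 2) d +
    contour m G ((a + b) / 2) b ((c + d) / 2) d).
Proof.
rewrite /contour !sideS.
have tele (V : zmodType) (x y z : V) : (y - x) + (z - y) = z - x.
  by rewrite addrC subrKA.
have regroup (V : zmodType) (v1 v2 v3 v4 h1 h2 h3 h4 : V) :
    (v1 + h1 + (v2 + h2)) + (v3 + h3 + (v4 + h4)) =
    (v1 + v2 + (v3 + v4)) + (h1 + h3 + (h2 + h4)).
  by rewrite (addrACA v1) (addrACA v3) (addrACA (v1 + v2)) (addrACA h1).
rewrite regroup -!scalerDr !tele !subrKA !opprD.
by congr ('i *: _ + _); exact: addrACA.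
Qed.

Lemma contourD m G H a b c d :
  contour m (fun x y => G x y + H x y) a b c d = contour m G a b c d + contour m H a b c d.
Proof.
rewrite /contour (sideD m (G b) (H b)) (sideD m (G a) (H a)).
rewrite (sideD m (G^~ c) (H^~ c)) (sideD m (G^~ d) (H^~ d)).
rewrite !opprD (addrACA (side m (G b) c d)).
by rewrite (addrACA (side m (G^~ c) a b)) scalerDr; exact: addrACA.
Qed.

Lemma rnorm_contour m G a b c d (k : R) : a <= b -> c <= d ->
  (forall x y, a <= x <= b -> c <= y <= d -> rnorm (G x y) <= k) ->
  rnorm (contour m G a b c d) <= 2 * ((b - a) + (d - c)) * k.
Proof.
move=> ab cd Gk; rewrite /contour.
have h1 : rnorm (side m (G b) c d) <= (d - c) * k.
  by apply: rnorm_side => // t ht; apply: Gk => //; rewrite ab lexx.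
have h2 : rnorm (side m (G a) c d) <= (d - c) * k.
  by apply: rnorm_side => // t ht; apply: Gk => //; rewrite ab lexx.
have h3 : rnorm (side m (G^~ c) a b) <= (b - a) * k.
  by apply: rnorm_side => // t ht; apply: Gk => //; rewrite cd lexx.
have h4 : rnorm (side m (G^~ d) a b) <= (b - a) * k.
  by apply: rnorm_side => // t ht; apply: Gk => //; rewrite cd lexx.
apply: (le_trans (ler_rnormD _ _)); rewrite rnormZi.
have := ler_rnormB (side m (G b) c d) (side m (G a) c d).
have := ler_rnormB (side m (G^~ c) a b) (side m (G^~ d) a b).
by lra.
Qed.

Lemma dyadic_mean_complex_affine m (w : R -> R[i]) (u A : E) a b :
  (forall s t, w ((s + t) / 2) = 2^-1 * (w s + w t)) ->
  dyadic_mean m (fun t => u + w t *: A) a b = u + w ((a + b) / 2) *: A.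
Proof.
move=> wP; rewrite dyadic_mean_affine// => s t.
rewrite addrACA -scalerDl scalerDr scalerA -wP; congr (_ + _).
by rewrite -mulr2n -[u *+ 2]scaler_nat scalerA mulVf ?scale1r// pnatr_eq0.
Qed.

(** Midpoint sums are exact on affine functions, so Cauchy's theorem for these holds at every level,
    without a limit. *)
Lemma contour_affine m (u A : E) a b c d :
  contour m (fun x y => u + (x +i* y) *: A) a b c d = 0.
Proof.
have hv x : dyadic_mean m (fun t => u + (x +i* t) *: A) c d =
    u + (x +i* ((c + d) / 2)) *: A.
  apply: (@dyadic_mean_complex_affine m (fun t => x +i* t)) => s t.
  by rewrite half_complex; apply/eqP; rewrite eq_complex /=; apply/andP; split;
    apply/eqP; field.
have hh y : dyadic_mean m (fun t => u + (t +i* y) *: A) a b =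
    u + (((a + b) / 2) +i* y) *: A.
  apply: (@dyadic_mean_complex_affine m (fun t => t +i* y)) => s t.
  by rewrite half_complex; apply/eqP; rewrite eq_complex /=; apply/andP; split;
    apply/eqP; field.
have sub (w w' : R[i]) : (u + w *: A) - (u + w' *: A) = (w - w') *: A.
  by rewrite opprD addrACA subrr add0r -scalerBl.
rewrite /contour /side !hv !hh -!scalerBr !sub !scalerA -scalerDl.
rewrite [X in X *: _](_ : _ = 0) ?scale0r//.
by apply/eqP; rewrite eq_complex /=; apply/andP; split; apply/eqP; ring.
Qed.

(** Complex differentiability at $p+iq$ with derivative [A], in real coordinates and with the
    $\ell^1$ size of the increment, which suits rectangles. *)
Definition holomorphic_xy G (p q : R) : Prop := exists A : E,
  forall e : R, 0 < e -> exists2 r : R, 0 < r & forall x y,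
    `|x - p| < r -> `|y - q| < r ->
    rnorm (G x y - G p q - ((x - p) +i* (y - q)) *: A) <= e * (`|x - p| + `|y - q|).

(** On a small rectangle, subtracting the first-order expansion bounds the contour sum by [e] times
    the sum of the squared sides. This bound is additive under division into quarters, so
    subdivision extends it to the whole rectangle. *)
Lemma goursat G a b c d : a <= b -> c <= d ->
  (forall p q, a <= p <= b -> c <= q <= d -> holomorphic_xy G p q) ->
  forall e : R, 0 < e ->
  exists N, forall m, (N <= m)%N -> rnorm (contour m G a b c d) <= e.
Proof.
move=> ab cd Ghol.
suff main e : 0 < e -> exists N, forall m, (N <= m)%N ->
    rnorm (contour m G a b c d) <= e * ((b - a) ^+ 2 + (d - c) ^+ 2).
  (* The summand 1 keeps [k] positive when the rectangle is a point. *)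
  move=> e e0; pose k := (b - a) ^+ 2 + (d - c) ^+ 2 + 1.
  have k0 : 0 < k by rewrite /k; have := sqr_ge0 (b - a); have := sqr_ge0 (d - c); lra.
  have [|N NP] := main (e / k); first exact: divr_gt0.
  exists N => m /NP /le_trans; apply.
  by rewrite mulrAC ler_pdivrMr// ler_pM2l// /k; lra.
move=> e0; apply: (@cousin_rectangle _ (fun a b c d => exists N, forall m,
  (N <= m)%N -> rnorm (contour m G a b c d) <= e * ((b - a) ^+ 2 + (d - c) ^+ 2))) => //.
  move=> x1 x2 y1 y2 _ _ [N1 h1] [N2 h2] [N3 h3] [N4 h4].
  (* Level [m.+1] on the rectangle rests on level [m] on the quarters, whence the successor. *)
  exists (maxn (maxn N1 N2) (maxn N3 N4)).+1 => -[//|m].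
  rewrite ltnS !geq_max => /andP[/andP[m1 m2] /andP[m3 m4]]; rewrite contourS.
  apply: (le_trans (ler_rnormD _ _)).
  have := h1 m m1; have := h2 m m2; have := h3 m m3; have := h4 m m4.
  have := ler_rnormD (contour m G x1 ((x1 + x2) / 2) y1 ((y1 + y2) / 2))
    (contour m G ((x1 + x2) / 2) x2 y1 ((y1 + y2) / 2)).
  have := ler_rnormD (contour m G x1 ((x1 + x2) / 2) ((y1 + y2) / 2) y2)
    (contour m G ((x1 + x2) / 2) x2 ((y1 + y2) / 2) y2).
  have -> : (x1 + x2) / 2 - x1 = (x2 - x1) / 2 by lra.
  have -> : x2 - (x1 + x2) / 2 = (x2 - x1) / 2 by lra.
  have -> : (y1 + y2) / 2 - y1 = (y2 - y1) / 2 by lra.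
  have -> : y2 - (y1 + y2) / 2 = (y2 - y1) / 2 by lra.
  have -> : e * ((x2 - x1) ^+ 2 + (y2 - y1) ^+ 2) =
    4 * (e * (((x2 - x1) / 2) ^+ 2 + ((y2 - y1) / 2) ^+ 2)) by field.
  by lra.
move=> p q pab qcd; have [A AP] := Ghol p q pab qcd.
have [|r r0 rP] := AP (e / 4); first by lra.
exists r => // x1 x2 y1 y2 px qy xr yr; exists 0%N => m _.
(* [H] is the first-order expansion of [G] at $p+iq$, whose contour sum vanishes, and [K] is the
   remainder. *)
pose H x y := G p q + (- (p +i* q)) *: A + (x +i* y) *: A.
pose K x y := G x y - G p q - ((x - p) +i* (y - q)) *: A.
have -> : G = fun x y => H x y + K x y.
  apply/funext => x; apply/funext => y; rewrite /H /K.
  rewrite -[in RHS](addrA (G p q)) -scalerDl.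
  have -> : - (p +i* q) + (x +i* y) = (x - p) +i* (y - q).
    by apply/eqP; rewrite eq_complex /=; apply/andP; split; apply/eqP; ring.
  by rewrite -[X in _ = _ + X]addrA -opprD [RHS]addrC subrK.
rewrite contourD contour_affine add0r.
(* Perimeter times the bound on the remainder: for sides $s,t$ this is $\frac e2(s+t)^2\le
   e(s^2+t^2)$. *)
apply: (@le_trans _ _ (2 * ((x2 - x1) + (y2 - y1)) *
    (e / 4 * ((x2 - x1) + (y2 - y1))))); last first.
  rewrite -subr_ge0.
  have -> : e * ((x2 - x1) ^+ 2 + (y2 - y1) ^+ 2) -
    2 * (x2 - x1 + (y2 - y1)) * (e / 4 * (x2 - x1 + (y2 - y1))) =
    e / 2 * ((x2 - x1) - (y2 - y1)) ^+ 2 by field.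
  by rewrite mulr_ge0 ?sqr_ge0//; lra.
apply: rnorm_contour; [lra|lra|] => x y hx hy.
have hxp : `|x - p| <= x2 - x1 by rewrite ler_norml; lra.
have hyq : `|y - q| <= y2 - y1 by rewrite ler_norml; lra.
apply: (le_trans (rP _ _ _ _)); [lra|lra|].
by rewrite ler_wpM2l//; lra.
Qed.

End Goursat.

Lemma derivable_estimate {K : numFieldType} {V : normedModType K} (g : K^o -> V) (z : K^o) :
  derivable g z 1 -> exists D : V, forall e : K, 0 < e ->
    \forall h \near nbhs (0 : K^o), `|g (z + h) - g z - h *: D| <= e * `|h|.
Proof.
move=> /derivable_nbhs /eqaddoP gz; exists ('D_1 g z) => e e0.
move: (gz e e0); apply: filterS => h /=.
by rewrite /= !fctE /= [h *: 1]mulr1 [h + z]addrC opprD addrA.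
Qed.

(** * The complex exponential in real coordinates *)

Section PolarExp.
Context {R : realType}.
Implicit Types (x y s t p q : R).

Lemma rnorm_complexE (z : R[i]^o) :
  rnorm z = Num.sqrt (complex.Re z ^+ 2 + complex.Im z ^+ 2).
Proof. by rewrite /rnorm normc_def. Qed.

Lemma rnormM (a b : R[i]^o) : rnorm (a * b : R[i]^o) = rnorm a * rnorm b.
Proof. exact: rnormZ. Qed.

Lemma rnorm_le_ReIm (z : R[i]^o) : rnorm z <= `|complex.Re z| + `|complex.Im z|.
Proof.
rewrite rnorm_complexE -[leRHS]ger0_norm ?addr_ge0// -sqrtr_sqr ler_wsqrtr//.
rewrite sqrrD !real_normK ?num_real//.
have := mulr_ge0 (normr_ge0 (complex.Re z)) (normr_ge0 (complex.Im z)); lra.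
Qed.

Lemma real_derivable_estimate (g : R -> R) (z D : R) : is_derive z 1 g D ->
  forall e : R, 0 < e -> exists2 r : R, 0 < r & forall h : R, `|h| < r ->
    `|g (z + h) - g z - h * D| <= e * `|h|.
Proof.
move=> gD e e0; have gz : derivable g z 1 by [].
move: gz => /derivable_nbhs /eqaddoP /(_ e e0) /nbhs_normP [r /= r0 rP].
exists r => // h hr; have := rP h; rewrite /= sub0r normrN => /(_ hr).
by rewrite !fctE /= derive_val [h *: 1]mulr1 [h + z]addrC opprD addrA.
Qed.

(** The exponential $e^{x+iy}$; it wraps the vertical line at $x$ around the circle of radius
    $e^x$. *)
Definition polar_exp x y : R[i]^o := (expR x * cos y) +i* (expR x * sin y).

Lemma polar_expD x y s t :
  polar_exp (x + s) (y + t) = polar_exp x y * polar_exp s t.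
Proof.
rewrite /polar_exp expRD cosD sinD; apply/eqP.
by rewrite eq_complex /=; apply/andP; split; apply/eqP; ring.
Qed.

Lemma rnorm_polar_exp x y : rnorm (polar_exp x y) = expR x.
Proof.
rewrite rnorm_complexE /= !exprMn -mulrDr cos2Dsin2 mulr1 sqrtr_sqr.
by rewrite ger0_norm// expR_ge0.
Qed.

Lemma polar_exp0 y : polar_exp 0 y = circle_point y.
Proof. by rewrite /polar_exp expR0 !mul1r. Qed.

(** The exponential has derivative 1 at 0, as follows from the real derivatives of [expR], [cos] and
    [sin] there. *)
Lemma polar_exp_estimate (e : R) : 0 < e -> exists2 r : R, 0 < r & forall s t,
  `|s| < r -> `|t| < r ->
  rnorm (polar_exp s t - 1 - (s +i* t) : R[i]^o) <= e * (`|s| + `|t|).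
Proof.
move=> e0.
have [r1 r10 h1] := real_derivable_estimate _ _ _ (is_derive_expR (0 : R)) _ ltr01.
(* The errors below add up to at most $k(|s|+5|t|)$, within the allowed $8k(|s|+|t|)$. *)
pose k := e / 8; have k0 : 0 < k by rewrite /k; lra.
have [r2 r20 h2] := real_derivable_estimate _ _ _ (is_derive_expR (0 : R)) _ k0.
have [r3 r30 h3] := real_derivable_estimate _ _ _ (is_derive_cos (0 : R)) _ k0.
have [r4 r40 h4] := real_derivable_estimate _ _ _ (is_derive_sin (0 : R)) _ k0.
(* The last bound gives $|s|<k/2$ and $|s|<1/2$, whence $|e^s-1|\le k$ and $|e^s|\le 2$. *)
pose r := Num.min (Num.min (Num.min r1 r2) (Num.min r3 r4)) (Num.min k 1 / 2).
have r0 : 0 < r by rewrite /r !lt_min !r10 r20 r30 r40 divr_gt0 ?lt_min ?k0 ?ltr01//.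
exists r => // s t; rewrite /r !lt_min.
move=> /andP[/andP[/andP[s1 s2] /andP[s3 s4]] s5].
move=> /andP[/andP[/andP[t1 t2] /andP[t3 t4]] t5].
have [{}s5 s6] : `|s| < k / 2 /\ `|s| < 1 / 2.
  by move: s5; rewrite ltr_pdivlMr// lt_min => /andP[] ? ?; split; lra.
have := h1 s s1; rewrite add0r expR0 mulr1 mul1r => {}h1.
have := h2 s s2; rewrite add0r expR0 mulr1 => {}h2.
have := h3 t t3; rewrite add0r cos0 sin0 oppr0 mulr0 subr0 => {}h3.
have := h4 t t4; rewrite add0r sin0 cos0 mulr1 subr0 => {}h4.
have es1 : `|expR s - 1| <= 2 * `|s|.
  by have := ler_normD (expR s - 1 - s) s; rewrite subrK; lra.
have es : `|expR s| <= 2.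
  by have := ler_normD (expR s - 1) 1; rewrite subrK normr1; lra.
apply: (le_trans (rnorm_le_ReIm _)) => /=.
have -> : expR s * cos t - 1 - s = expR s * (cos t - 1) + (expR s - 1 - s) by ring.
have -> : expR s * sin t - 0 - t = expR s * (sin t - t) + (expR s - 1) * t by ring.
have := ler_normD (expR s * (cos t - 1)) (expR s - 1 - s).
have := ler_normD (expR s * (sin t - t)) ((expR s - 1) * t).
rewrite !normrM.
have n1 := normr_ge0 s; have n2 := normr_ge0 t.
have : `|expR s| * `|cos t - 1| <= 2 * (k * `|t|) by apply: ler_pM.
have : `|expR s| * `|sin t - t| <= 2 * (k * `|t|) by apply: ler_pM.
have : `|expR s - 1| * `|t| <= k * `|t| by apply: ler_wpM2r => //; lra.
have ks : 0 <= k * `|s| by rewrite mulr_ge0// ltW.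
have kt : 0 <= k * `|t| by rewrite mulr_ge0// ltW.
have -> : e * (`|s| + `|t|) = 8 * (k * `|s|) + 8 * (k * `|t|) by rewrite /k; field.
lra.
Qed.

End PolarExp.

(** * Dyadic means of holomorphic functions on the unit circle *)

Section MeanValue.
Context {R : realType} {E : normedModType R[i]}.
Implicit Types (g : R[i]^o -> E).

Lemma holomorphic_estimate g (z : R[i]^o) : derivable g z 1 ->
  exists D : E, forall e : R, 0 < e -> exists2 r : R, 0 < r &
    forall h : R[i]^o, rnorm h < r -> rnorm (g (z + h) - g z - h *: D) <= e * rnorm h.
Proof.
move=> /derivable_estimate [D DP]; exists D => e e0.
have /DP /nbhs_rnormP [r r0 rP] : 0 < e%:C by rewrite ltcR.
exists r => // h; rewrite -(subr0 h) => /rP; rewrite subr0.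
by rewrite -lecR rmorphM /= !rnormE.
Qed.

(** The chain rule: the functional equation reduces the exponential to its expansion at 0, and the
    derivative is [z *: D]. *)
Lemma holomorphic_xy_polar_exp g (p q : R) : derivable g (polar_exp p q) 1 ->
  holomorphic_xy (fun x y => g (polar_exp x y)) p q.
Proof.
set z := polar_exp p q => /holomorphic_estimate [D DP].
exists (z *: D) => e e0.
(* [k] bounds the relative error of [g] and [l] that of the exponential; each contributes at most
   $\frac e2(|s|+|t|)$. The added 1 keeps the denominators positive. *)
pose k := e / (4 * (rnorm z + 1)); pose l := Num.min 1 (e / (2 * (rnorm z * rnorm D + 1))).
have z0 := rnorm_ge0 z; have D0 := rnorm_ge0 D.
have zD0 : 0 <= rnorm z * rnorm D by rewrite mulr_ge0.
have k0 : 0 < k by rewrite divr_gt0//; lra.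
have l0 : 0 < l by rewrite lt_min ltr01 divr_gt0//; lra.
have [r1 r10 h1] := DP k k0; have [r2 r20 h2] := polar_exp_estimate _ l0.
pose r := Num.min r2 (r1 / (4 * (rnorm z + 1))).
have r0 : 0 < r by rewrite lt_min r20 divr_gt0//; lra.
exists r => // x y; rewrite !lt_min => /andP[x1 x2] /andP[y1 y2].
set s := x - p; set t := y - q; pose u : R[i]^o := s +i* t.
have -> : polar_exp x y = z * polar_exp s t.
  by rewrite -polar_expD /s /t; congr polar_exp; ring.
pose rho : R[i]^o := polar_exp s t - 1 - u.
have hrho : rnorm rho <= l * (`|s| + `|t|) by exact: h2.
have hu : rnorm u <= `|s| + `|t| by exact: rnorm_le_ReIm.
pose h : R[i]^o := z * (u + rho).
have -> : z * polar_exp s t = z + h.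
  by rewrite /h /rho [u + _]addrC subrK mulrBr mulr1 addrC subrK.
set S := `|s| + `|t|.
have S0 : 0 <= S by rewrite addr_ge0.
have l1 : l <= 1 by rewrite ge_min lexx.
have hh : rnorm h <= rnorm z * (2 * S).
  rewrite rnormM ler_wpM2l//; apply: (le_trans (ler_rnormD _ _)).
  have : l * S <= 1 * S by rewrite ler_wpM2r.
  by rewrite -/S in hrho hu; lra.
have hr1 : rnorm h < r1.
  apply: (le_lt_trans hh); move: x2 y2; rewrite !ltr_pdivlMr; try lra.
  rewrite -/s -/t => x2 y2.
  apply: (@le_lt_trans _ _ ((rnorm z + 1) * (2 * S))); last by rewrite /S; lra.
  by rewrite ler_wpM2r//; lra.
(* The error of [g] at the increment $h=z(e^{s+it}-1)$, plus the error of the exponential carried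
   through [D]. *)
have -> : g (z + h) - g z - u *: (z *: D) =
    (g (z + h) - g z - h *: D) + (z * rho) *: D.
  rewrite -[RHS]addrA; congr (_ + _).
  by rewrite /h mulrDr scalerDl opprD -addrA addNr addr0 scalerA mulrC.
apply: (le_trans (ler_rnormD _ _)).
have := h1 h hr1; rewrite rnormZ -/(rnorm (z * rho : R[i]^o)) rnormM.
have : k * rnorm h <= e / 2 * S.
  apply: (@le_trans _ _ (k * (rnorm z * (2 * S)))); first by rewrite ler_wpM2l// ltW.
  have -> : k * (rnorm z * (2 * S)) = e / 2 * S * (rnorm z / (rnorm z + 1)).
    by rewrite /k; field; rewrite gt_eqF//; lra.
  by rewrite ler_piMr ?mulr_ge0 ?ler_pdivrMr ?divr_ge0 ?(ltW e0) ?mul1r ?lerDl//; lra.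
have : rnorm z * rnorm rho * rnorm D <= e / 2 * S.
  rewrite mulrAC.
  apply: (@le_trans _ _ (rnorm z * rnorm D * (e / (2 * (rnorm z * rnorm D + 1)) * S))).
    rewrite ler_wpM2l//; apply: (le_trans hrho); rewrite ler_wpM2r//.
    by rewrite ge_min lexx orbT.
  set v := rnorm z * rnorm D; rewrite -/v in zD0.
  have -> : v * (e / (2 * (v + 1)) * S) = e / 2 * S * (v / (v + 1)).
    by field; rewrite gt_eqF//; lra.
  by rewrite ler_piMr ?mulr_ge0 ?ler_pdivrMr ?divr_ge0 ?(ltW e0) ?mul1r ?lerDl//; lra.
by lra.
Qed.

(** For given [e] one rectangle $[a,0]\times[0,2\pi]$ suffices: the horizontal sides cancel by
    periodicity, the right side is the unit circle, and the left one is a circle so small that [g]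
    is within [e / 2] of [g 0] on it. *)
Lemma dyadic_mean_holomorphic (U : set R[i]^o) g :
  @closed_unit_disc R `<=` U -> holomorphic_on U g ->
  forall e : R, 0 < e -> exists N, forall m, (N <= m)%N ->
    rnorm (dyadic_mean m (g \o @circle_point R) 0 (2 * pi) - g 0) <= e.
Proof.
move=> dU [_ gU] e e0.
have U0 : U 0 by apply: dU; rewrite /closed_unit_disc /= normr0 ler01.
have /nbhs_rnormP [r r0 rP] : \forall z \near nbhs (0 : R[i]^o), rnorm (g z - g 0) < e / 2.
  have gc : {for (0 : R[i]^o), continuous g}.
    by apply/differentiable_continuous/derivable1_diffP/gU.
  apply: (gc [set v | rnorm (v - g 0) < e / 2]).
  by apply/nbhs_rnormP; exists (e / 2) => //; lra.
(* The radius $e^a$ is below [r], and at most 1 so that $a\le 0$. *)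
pose a := ln (Num.min (r / 2) 1).
have m0 : 0 < Num.min (r / 2) 1 by rewrite lt_min; lra.
have a0 : a <= 0 by rewrite /a ln_le0// ge_min lexx orbT.
have ar : expR a < r by rewrite lnK// gt_min; lra.
have pi0 := pi_gt0 R; have tpi0 : 0 <= 2 * pi :> R by lra.
pose G x y := g (polar_exp x y).
(* The contour sum will have the norm of $2\pi$ times a difference of means, whence the factor in
   the tolerance. *)
have [||p q pa qa||N NP] := @goursat R E G a 0 0 (2 * pi) _ _ _ (e / 2 * (2 * pi)).
- exact: a0.
- exact: tpi0.
- apply: holomorphic_xy_polar_exp; apply: gU; apply: dU.
  rewrite /closed_unit_disc /= -rnormE rnorm_polar_exp -[1]/(1%:C) lecR.
  by rewrite -expR0 ler_expR; lra.
- by rewrite mulr_gt0//; lra.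
exists N => m /NP; rewrite /contour.
have -> : G^~ (2 * pi) = G^~ 0.
  apply/funext => x; rewrite /G /polar_exp mulr_natl.
  by rewrite cos2pi sin2pi cos0 sin0.
rewrite subrr addr0 rnormZi /side -scalerBr rnormZr subr0 ger0_norm// mulrC.
rewrite ler_pM2r; last by lra.
have -> : G 0 = g \o @circle_point R by apply/funext => y; rewrite /G polar_exp0.
have : rnorm (dyadic_mean m (G a) 0 (2 * pi) - g 0) <= e / 2.
  apply: (@dyadic_mean_in R _ E m [set v | rnorm (v - g 0) <= e / 2]) => //=.
    move=> u v uk vk.
    have -> : 2^-1 *: (u + v) - g 0 = 2^-1 *: ((u - g 0) + (v - g 0)).
      rewrite addrACA -opprD scalerBr; congr (_ - _).
      by rewrite -mulr2n -[g 0 *+ 2]scaler_nat scalerA mulVf ?scale1r// pnatr_eq0.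
    exact: rnorm_mid.
  by move=> t _; apply/ltW/rP; rewrite subr0 rnorm_polar_exp.
have := ler_rnorm_dist (dyadic_mean m (g \o @circle_point R) 0 (2 * pi))
  (dyadic_mean m (G a) 0 (2 * pi)) (g 0).
by lra.
Qed.

End MeanValue.

(** * Riemann sums and integrals of continuous functions *)

Section RiemannSums.
Context {R : realType}.
Implicit Types (h : R -> R) (a b : R).
Local Notation mu := (@lebesgue_measure R).

Lemma continuous_integrable_itv h a b : continuous h ->
  mu.-integrable `[a, b] (EFin \o h).
Proof.
move=> hc; apply: continuous_compact_integrable; first exact: segment_compact.
exact: continuous_subspaceT.
Qed.

Lemma Rintegral_split h a b c : continuous h -> a <= c -> c <= b ->
  (\int[mu]_(t in `[a, b]) h t =
  \int[mu]_(t in `[a, c]) h t + \int[mu]_(t in `[c, b]) h t)%R.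
Proof.
move=> hc ac cb; have hi := continuous_integrable_itv _ _ _ hc.
have := @Rintegral_itvB R h (BLeft a) (BRight b) c (hi a b).
rewrite !bnd_simp => /(_ ac cb) /eqP; rewrite subr_eq => /eqP ->.
rewrite addrC Rintegral_itv_obnd_cbnd//.
by apply: integrableS (hi a b) => //; apply: subset_itvr; rewrite bnd_simp.
Qed.

Lemma Rintegral_itv_cst a b (k : R) : a <= b ->
  (\int[mu]_(t in `[a, b]) k = k * (b - a))%R.
Proof.
move=> ab; rewrite Rintegral_cst//= lebesgue_measure_itv /= lte_fin.
by move: ab; rewrite le_eqVlt => /orP[/eqP ->|->]; rewrite ?ltxx ?subrr.
Qed.

Lemma le_Rintegral_itv h1 h2 a b : continuous h1 -> continuous h2 ->
  (forall t, a <= t <= b -> h1 t <= h2 t) ->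
  (\int[mu]_(t in `[a, b]) h1 t <= \int[mu]_(t in `[a, b]) h2 t)%R.
Proof.
by move=> h1c h2c h12; apply: le_Rintegral => //; exact: continuous_integrable_itv.
Qed.

(** By continuity [h2 - h1] exceeds half its value at [s] on a nondegenerate interval containing
    [s], which contributes a positive amount. *)
Lemma lt_Rintegral_itv h1 h2 a b s : continuous h1 -> continuous h2 -> a < b ->
  (forall t, a <= t <= b -> h1 t <= h2 t) -> a <= s <= b -> h1 s < h2 s ->
  (\int[mu]_(t in `[a, b]) h1 t < \int[mu]_(t in `[a, b]) h2 t)%R.
Proof.
move=> h1c h2c ab h12 sab hs.
have hc : continuous (fun t => h2 t - h1 t) by move=> t; apply: cvgB; [exact: h2c|exact: h1c].
rewrite -subr_gt0 -RintegralB//; try exact: continuous_integrable_itv.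
pose k := (h2 s - h1 s) / 2; have k0 : 0 < k by rewrite /k; lra.
have /cvgrPdist_lt /(_ _ k0) /nbhs_normP [r /= r0 rP] := hc s.
(* The window of radius [r / 2] around [s], cut to $[a,b]$; it remains nondegenerate when [s] is an
   endpoint. *)
pose x := Num.max a (s - r / 2); pose y := Num.min b (s + r / 2).
have ax : a <= x by rewrite /x le_max lexx.
have yb : y <= b by rewrite /y ge_min lexx.
have xr : s - r / 2 <= x by rewrite /x le_max lexx orbT.
have yr : y <= s + r / 2 by rewrite /y ge_min lexx orbT.
have xy : x < y.
  by rewrite /x /y lt_min !gt_max ab /=; apply/andP; split; [|apply/andP; split]; lra.
rewrite (Rintegral_split _ _ _ _ hc ax)//; last by lra.
rewrite (Rintegral_split _ _ _ _ hc (ltW xy) yb).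
have ge0 c d : a <= c -> d <= b ->
    (0 <= \int[mu]_(t in `[c, d]) (h2 t - h1 t))%R.
  move=> ac db; apply: Rintegral_ge0 => t /=; rewrite in_itv /= => tcd.
  by rewrite subr_ge0; apply: h12; lra.
apply: ltr_wpDl; first by apply: ge0; lra.
apply: ltr_wpDr; first by apply: ge0; lra.
apply: (@lt_le_trans _ _ (k * (y - x))); first by rewrite mulr_gt0// subr_gt0.
rewrite -Rintegral_itv_cst ?(ltW xy)//.
apply: le_Rintegral_itv; [exact: cst_continuous|exact: hc|] => t txy.
have := rP t; rewrite /= ltr_norml => /(_ _).
by rewrite ltr_norml => H; have := H ltac:(lra); rewrite /k; lra.
Qed.

(** As for Goursat's theorem, in one dimension: on a short interval of length $l$ around $p$, the
    sum and the integral both lie within $el/2$ of $h(p)\,l$, and the resulting bound is additive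
    under halving. *)
Lemma dyadic_mean_cvg_Rintegral h a b : continuous h -> a <= b ->
  forall e, 0 < e -> exists N, forall m, (N <= m)%N ->
  `|(b - a) * dyadic_mean m (h : R -> R^o) a b - \int[mu]_(t in `[a, b]) h t|%R
    <= e * (b - a).
Proof.
move=> hc ab e e0.
apply: (@cousin_itv _ (fun a b => a <= b -> exists N, forall m, (N <= m)%N ->
  `|(b - a) * dyadic_mean m (h : R -> R^o) a b - \int[mu]_(t in `[a, b]) h t|%R
    <= e * (b - a)) a b) => //.
  move=> x y xy h1 h2 _.
  have [|N1 {}h1] := h1; first by lra.
  have [|N2 {}h2] := h2; first by lra.
  exists (maxn N1 N2).+1 => -[//|m]; rewrite ltnS geq_max => /andP[m1 m2].
  rewrite (@Rintegral_split _ x y ((x + y) / 2))//; [|lra|lra].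
  move: (h1 m m1) (h2 m m2) => /=.
  set M1 := dyadic_mean m _ _ _; set M2 := dyadic_mean m _ _ _.
  set I1 := Rintegral _ _ _; set I2 := Rintegral _ _ _ => {}h1 {}h2.
  have -> : (y - x) * (2^-1 *: (M1 + M2)) - (I1 + I2) =
    (((x + y) / 2 - x) * M1 - I1) + ((y - (x + y) / 2) * M2 - I2).
    by rewrite /GRing.scale /=; field.
  by apply: (le_trans (ler_normD _ _)); lra.
move=> p _.
have e20 : 0 < e / 2 by lra.
have /cvgrPdist_lt /(_ _ e20) /nbhs_normP [r /= r0 rP] := hc p.
exists r => // x y xpy xyr xy; exists 0%N => m _.
have hb t : x <= t <= y -> h p - e / 2 <= h t <= h p + e / 2.
  move=> txy; have := rP t; rewrite /= ltr_norml => /(_ _).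
  rewrite ltr_norml => H; have := H ltac:(lra); lra.
have : (\int[mu]_(t in `[x, y]) (h p - e / 2) <= \int[mu]_(t in `[x, y]) h t)%R.
  apply: le_Rintegral_itv => [||t /hb /andP[]//]; [exact: cst_continuous|exact: hc].
have : (\int[mu]_(t in `[x, y]) h t <= \int[mu]_(t in `[x, y]) (h p + e / 2))%R.
  apply: le_Rintegral_itv => [||t /hb /andP[]//]; [exact: hc|exact: cst_continuous].
rewrite !Rintegral_itv_cst//.
have : h p - e / 2 <= dyadic_mean m (h : R -> R^o) x y <= h p + e / 2.
  apply: (@dyadic_mean_in R R R^o m [set v | h p - e / 2 <= v <= h p + e / 2]) => //.
  by move=> u v /=; rewrite /GRing.scale /=; lra.
set M := dyadic_mean _ _ _ _; set I := Rintegral _ _ _.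
move=> /andP[M1 M2] I2 I1.
have l0 : 0 <= y - x by rewrite subr_ge0.
have := ler_wpM2l l0 M1; have := ler_wpM2l l0 M2.
rewrite ler_norml; lra.
Qed.

End RiemannSums.

(** * Midpoint convexity and Jensen's inequality *)

Section MidpointConvexity.
Context {R : realType} {E : normedModType R[i]}.
Implicit Types (X : set E) (f : E -> R) (u v : E).

(** [convex_set] takes its weights in the unit interval of [R[i]], to which [t%:C] belongs. *)
Lemma convex_set_segment X (u v : E) (t : R) : convex_set X ->
  X u -> X v -> 0 <= t <= 1 -> X (t%:C *: u + (1 - t)%:C *: v).
Proof.
move=> cX Xu Xv /andP[t0 t1].
have t0' : 0 <= t%:C by rewrite lecR.
have t1' : t%:C <= 1 by rewrite -[1]/(1%:C) lecR.
have := cX u v (Itv01 t0' t1') (mem_set Xu) (mem_set Xv).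
by rewrite inE /conv /= rmorphB.
Qed.

(** The affine path from [u] at -1 to [v] at 1, with the midpoint at 0; testing convexity on it
    gives the midpoint inequality. *)
Definition segment_map u v (t : R) : E :=
  ((1 - t) / 2)%:C *: u + ((1 + t) / 2)%:C *: v.

Lemma segment_map_affine u v : affine_segment (segment_map u v).
Proof.
move=> s t k _ _ _; rewrite /segment_map !scalerDr !scalerA addrACA -!scalerDl.
by rewrite -!rmorphM -!rmorphD; congr (_%:C *: _ + _%:C *: _); field.
Qed.

Lemma segment_mapN1 u v : segment_map u v (-1) = u.
Proof.
by rewrite /segment_map opprK subrr mul0r scale0r addr0 divff ?scale1r ?pnatr_eq0.
Qed.

Lemma segment_map1 u v : segment_map u v 1 = v.
Proof.
by rewrite /segment_map subrr mul0r scale0r add0r divff ?scale1r ?pnatr_eq0.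
Qed.

Lemma segment_map0 u v : segment_map u v 0 = 2^-1 *: (u + v).
Proof. by rewrite /segment_map subr0 addr0 mul1r half_complex scalerDr. Qed.

Lemma segment_map_in X u v (t : R) : convex_set X -> X u -> X v ->
  t \in `[-1, 1] -> X (segment_map u v t).
Proof.
move=> cX Xu Xv; rewrite in_itv /= => t1; rewrite /segment_map.
have -> : (1 + t) / 2 = 1 - (1 - t) / 2 by field.
by apply: convex_set_segment => //; lra.
Qed.

Lemma midpoint_in X u v : convex_set X -> X u -> X v -> X (2^-1 *: (u + v)).
Proof.
move=> cX Xu Xv; rewrite -segment_map0; apply: segment_map_in => //.
by rewrite in_itv /=; lra.
Qed.

Lemma convex_on_midpoint X f u v : convex_set X -> convex_on X f -> X u -> X v ->
  f (2^-1 *: (u + v)) <= (f u + f v) / 2.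
Proof.
move=> cX cf Xu Xv.
rewrite -segment_map0 -[in leRHS](segment_mapN1 u v) -[X in _ + f X](segment_map1 u v).
apply: cf; first exact: segment_map_affine.
by move=> t; exact: segment_map_in.
Qed.

Lemma strictly_convex_on_midpoint X f u v : convex_set X -> strictly_convex_on X f ->
  X u -> X v -> u <> v -> f (2^-1 *: (u + v)) < (f u + f v) / 2.
Proof.
move=> cX [_ cf] Xu Xv uv.
rewrite -segment_map0 -[in ltRHS](segment_mapN1 u v) -[X in _ + f X](segment_map1 u v).
apply: cf; first exact: segment_map_affine.
  by move=> t; exact: segment_map_in.
exists (-1), 1; split; rewrite ?segment_mapN1 ?segment_map1//; rewrite in_itv /=; lra.
Qed.

(** The midpoint inequality is applied at each halving; the partial means stay in [X] by
    convexity. *)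
Lemma jensen_dyadic_mean X f m (g : R -> E) (a b : R) : convex_set X -> convex_on X f ->
  a <= b -> (forall t, a <= t <= b -> X (g t)) ->
  f (dyadic_mean m g a b) <= dyadic_mean m (f \o g : R -> R^o) a b.
Proof.
move=> cX cf; elim: m a b => [//|m IH] a b ab gX /=.
have Xm (c d : R) : c <= d -> a <= c -> d <= b -> X (dyadic_mean m g c d).
  move=> cd ac db; apply: dyadic_mean_in => //; first by move=> u v; exact: midpoint_in.
  by move=> t ht; apply: gX; lra.
apply: (le_trans (convex_on_midpoint _ _ _ _ cX cf _ _)); [apply: Xm; lra|apply: Xm; lra|].
rewrite mulrC /GRing.scale /= ler_wpM2l ?invr_ge0// lerD//; apply: IH; try lra;
  by move=> t ht; apply: gX; lra.
Qed.

End MidpointConvexity.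

Lemma derivable_affine {K : numFieldType} (b w : K^o) :
  derivable (fun z : K^o => 1 + b * z : K^o) w 1.
Proof.
apply: derivableD; first exact: derivable_cst.
by apply: derivableM; [exact: derivable_cst|exact: derivable_id].
Qed.

Lemma derivable_fractional_linear {K : numFieldType} (a b z : K^o) : 1 + b * z != 0 ->
  derivable (fun w : K^o => (w + a) / (1 + b * w) : K^o) z 1.
Proof.
move=> d0; apply: derivableM.
  by apply: derivableD; [exact: derivable_id|exact: derivable_cst].
apply: derivableV => //; exact: derivable_affine.
Qed.

(** * The unit circle and the Moebius maps of the disc *)

Section Circle.
Context {R : realType}.
Implicit Types (t : R) (z a : R[i]^o).

Lemma unit_disc_rnorm z : closed_unit_disc z <-> rnorm z <= 1.
Proof. by rewrite -lecR rnormE. Qed.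

Lemma rnorm_circle_point t : rnorm (circle_point t : R[i]^o) = 1.
Proof. by rewrite -polar_exp0 rnorm_polar_exp expR0. Qed.

Lemma circle_point_disc t : closed_unit_disc (circle_point t).
Proof. by apply/unit_disc_rnorm; rewrite rnorm_circle_point. Qed.

Lemma continuous_circle_point : continuous (@circle_point R).
Proof.
move=> t P /nbhs_rnormP [e e0 eP].
have e20 : 0 < e / 2 by rewrite divr_gt0.
have /cvgrPdist_lt /(_ _ e20) c1 := @continuous_cos R t.
have /cvgrPdist_lt /(_ _ e20) s1 := @continuous_sin R t.
apply: filterS2 c1 s1 => s c1 s1; apply: eP.
apply: (le_lt_trans (rnorm_le_ReIm _)) => /=.
by rewrite distrC [X in _ + X]distrC; lra.
Qed.

(** [acos] parametrises the upper half circle, and $t\mapsto 2\pi-t$ reflects it to the lower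
    half. *)
Lemma circle_point_surj z : rnorm z = 1 ->
  exists2 t : R, 0 <= t <= 2 * pi & circle_point t = z.
Proof.
case: z => x y; rewrite rnorm_complexE /= => xy1.
have {}xy1 : x ^+ 2 + y ^+ 2 = 1.
  by rewrite -[LHS]sqr_sqrtr ?xy1 ?expr1n// addr_ge0 ?sqr_ge0.
have x1 : -1 <= x <= 1.
  rewrite -ler_norml -(@ler_pXn2r _ 2) ?nnegrE// real_normK ?num_real// expr1n.
  by have := sqr_ge0 y; lra.
have [axpi cosax] := acos_def x1.
have sinax : sin (acos x) = `|y|.
  by rewrite sin_acos// -sqrtr_sqr; congr Num.sqrt; lra.
have pi0 := pi_ge0 R.
have [y0|y0] := leP 0 y.
  exists (acos x); first by lra.
  by rewrite /circle_point cosax sinax ger0_norm.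
exists (2 * pi - acos x); first by lra.
rewrite /circle_point mulr_natl cosB sinB cos2pi sin2pi cosax sinax ltr0_norm//.
by congr (_ +i* _); ring.
Qed.

(** For $|a|<1$, the automorphism of the unit disc that takes 0 to [a]. *)
Definition moebius a z : R[i]^o := (z + a) / (1 + conjc a * z).

Lemma sqr_rnorm z : rnorm z ^+ 2 = complex.Re z ^+ 2 + complex.Im z ^+ 2.
Proof. by rewrite rnorm_complexE sqr_sqrtr// addr_ge0 ?sqr_ge0. Qed.

Lemma rnorm_conjc a : rnorm (conjc a : R[i]^o) = rnorm a.
Proof. by rewrite !rnorm_complexE; case: a => x y /=; rewrite sqrrN. Qed.

Lemma moebius_den_neq0 a z : rnorm a < 1 -> rnorm z <= 1 -> 1 + conjc a * z != 0.
Proof.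
move=> a1 z1; apply/eqP => /eqP; rewrite addrC addr_eq0 => /eqP az.
have : rnorm (conjc a * z : R[i]^o) = 1.
  by rewrite az rnormN rnorm_complexE /= expr1n expr0n addr0 sqrtr1.
rewrite rnormM rnorm_conjc => h.
have := ler_wpM2l (rnorm_ge0 a) z1; rewrite h mulr1; lra.
Qed.

(** For $|a|<1$ the right-hand side is nonnegative on the disc and zero on the circle, so
    [moebius a] preserves both. *)
Lemma moebius_defect a z : rnorm (1 + conjc a * z : R[i]^o) ^+ 2 - rnorm (z + a : R[i]^o) ^+ 2 =
  (1 - rnorm a ^+ 2) * (1 - rnorm z ^+ 2).
Proof. by rewrite !sqr_rnorm; case: a z => [x y] [p q] /=; ring. Qed.

Lemma rnorm_moebius a z : rnorm a < 1 -> rnorm z <= 1 ->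
  rnorm (moebius a z) <= 1 /\ (rnorm z = 1 -> rnorm (moebius a z) = 1).
Proof.
move=> a1 z1; set d : R[i]^o := 1 + conjc a * z.
have d0 : d != 0 := moebius_den_neq0 a z a1 z1.
have E : rnorm (moebius a z) * rnorm d = rnorm (z + a).
  by rewrite -rnormM /moebius -/d -mulrA mulVf// mulr1.
have := moebius_defect a z; rewrite -/d -E.
have dpos : 0 < rnorm d.
  rewrite lt_neqAle rnorm_ge0 andbT eq_sym; apply/negP => /eqP /rnorm0_eq0 h.
  by move/eqP: d0.
have m0 := rnorm_ge0 (moebius a z).
set m := rnorm (moebius a z); rewrite -/m in m0.
have := rnorm_ge0 a => a0 H; split.
  rewrite -(@ler_pXn2r _ 2) ?nnegrE// expr1n.
  rewrite -(@ler_pM2r _ (rnorm d ^+ 2)) ?exprn_gt0// mul1r -exprMn -subr_ge0 H.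
  by rewrite mulr_ge0// subr_ge0 expr_le1 ?rnorm_ge0// ltW.
move=> z1'; move: H; rewrite z1' expr1n subrr mulr0 => /eqP; rewrite subr_eq0.
rewrite exprMn -[X in X == _]mul1r => /eqP /mulIf h.
have /eqP : 1 = m ^+ 2 by apply: h; rewrite expf_neq0// gt_eqF.
by rewrite eq_sym sqrp_eq1// => /eqP.
Qed.

Lemma derivable_moebius a z : 1 + conjc a * z != 0 ->
  derivable (moebius a : R[i]^o -> R[i]^o) z 1.
Proof. exact: derivable_fractional_linear. Qed.

End Circle.


(** * Sub-mean value inequalities *)

Section Submean.
Context {R : realType} {E : normedModType R[i]}.
Implicit Types (X : set E) (f : E -> R) (g : R[i]^o -> E) (U : set R[i]^o).
Local Notation mu := (@lebesgue_measure R).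

Lemma holomorphic_on_continuous U g z : holomorphic_on U g -> U z -> {for z, continuous g}.
Proof. by move=> [_ gU] /gU; move=> /derivable1_diffP /differentiable_continuous. Qed.

Lemma continuous_on_circle X f U g : {in X, continuous f} ->
  @closed_unit_disc R `<=` U -> holomorphic_on U g -> (forall z, U z -> X (g z)) ->
  continuous (fun t => f (g (circle_point t)) : R).
Proof.
move=> fc dU gU gX t; have Ut : U (circle_point t) by exact/dU/circle_point_disc.
apply: (@continuous_comp _ _ _ (g \o @circle_point R) f).
  apply: continuous_comp; first exact: continuous_circle_point.
  exact: holomorphic_on_continuous gU Ut.
by apply: fc; rewrite inE; exact: gX.
Qed.

(** Jensen's inequality is used at a single level [m], large enough for the means of [g] and of
    [f \o g] to be near their limits; each approximation costs [e / 2]. *)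
Lemma convex_submean X f U g : convex_set X -> {in X, continuous f} -> convex_on X f ->
  @closed_unit_disc R `<=` U -> holomorphic_on U g -> (forall z, U z -> X (g z)) ->
  f (g 0) <= (2 * pi)^-1 * (\int[mu]_(t in `[0%R, (2 * pi)%R]) f (g (circle_point t)))%R.
Proof.
move=> cX fc cf dU gU gX.
have hc := continuous_on_circle _ _ _ _ fc dU gU gX.
have X0 : X (g 0) by apply/gX/dU/unit_disc_rnorm; rewrite rnorm0.
have pi0 := pi_gt0 R; have tpi0 : 0 < 2 * pi :> R by lra.
apply/ler_addgt0Pr => e e0.
have e20 : 0 < e / 2 by lra.
have : \forall v \near g 0, `|f (g 0) - f v| < e / 2.
  by have /cvgrPdist_lt := fc _ (mem_set X0); apply.
move=> /nbhs_rnormP [r r0 rP].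
have r20 : 0 < r / 2 by lra.
have [N1 h1] := dyadic_mean_holomorphic U g dU gU _ r20.
have [N2 h2] := dyadic_mean_cvg_Rintegral _ _ _ hc (ltW tpi0) _ e20.
pose m := maxn N1 N2.
have {}h1 := h1 m (leq_maxl _ _); have {}h2 := h2 m (leq_maxr _ _).
have r2r : r / 2 < r by lra.
have := rP _ (le_lt_trans h1 r2r).
have : f (dyadic_mean m (g \o @circle_point R) 0 (2 * pi)) <=
    dyadic_mean m (fun t => f (g (circle_point t)) : R^o) 0 (2 * pi).
  apply: jensen_dyadic_mean cX cf (ltW tpi0) _ => t _.
  exact/gX/dU/circle_point_disc.
move: h2; rewrite subr0.
set M := dyadic_mean _ _ _ _; set I := Rintegral _ _ _.
set v := f _ => h2 Mv h3.
rewrite mulrC -lerBlDr ler_pdivlMr//.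
move: h2 h3; rewrite ler_norml ltr_norml => /andP[_ h2] /andP[_ h3].
have : (f (g 0) - e) * (2 * pi) <= (M - e / 2) * (2 * pi) by rewrite ler_pM2r//; lra.
lra.
Qed.

(** For $|a|<1$, [g \o moebius a] has value [g a] at 0 and only the value [g 0] on the circle, so
    the sub-mean inequality gives $|g(a)-g(0)|\le 0$. *)
Lemma circle_constant U g : @closed_unit_disc R `<=` U -> holomorphic_on U g ->
  (forall t : R, 0 <= t <= 2 * pi -> g (circle_point t) = g 0) ->
  forall z, closed_unit_disc z -> g z = g 0.
Proof.
move=> dU gU gcst a /unit_disc_rnorm; rewrite le_eqVlt => /orP[/eqP a1|a1].
  by have [t /gcst <- ->] := circle_point_surj a a1.
(* A neighbourhood of the disc where the denominator does not vanish and the image stays in [U]. *)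
pose V := [set z : R[i]^o | 1 + conjc a * z != 0 /\ U (moebius a z)].
have dV : @closed_unit_disc R `<=` V.
  move=> z /unit_disc_rnorm z1; split; first exact: moebius_den_neq0.
  by apply/dU/unit_disc_rnorm; have [] := rnorm_moebius a z a1 z1.
have Vmoeb z : V z -> {for z, continuous (moebius a)}.
  by move=> [z0 _]; apply/differentiable_continuous/derivable1_diffP/derivable_moebius.
have gV : holomorphic_on V (g \o moebius a).
  split.
    rewrite openE => z Vz; have [z0 Uz] := Vz.
    have cden : {for z, continuous (fun w : R[i]^o => 1 + conjc a * w : R[i]^o)}.
      exact/differentiable_continuous/derivable1_diffP/derivable_affine.
    have nU : nbhs (moebius a z) U by apply: open_nbhs_nbhs; split => //; case: gU.
    have n1 : \forall w \near z, U (moebius a w) by exact: (Vmoeb z Vz U nU).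
    have n2 : \forall w \near z, 1 + conjc a * w != 0.
      apply: (cden [set w : R[i]^o | w != 0]).
      apply/nbhs_rnormP; exists (rnorm (1 + conjc a * z : R[i]^o)).
        by rewrite lt_neqAle rnorm_ge0 andbT eq_sym; apply: contra_neq z0 => /rnorm0_eq0.
      move=> y; apply: contraTneq => ->.
      by rewrite sub0r rnormN ltxx.
    have : \forall w \near z, V w by apply: filterS2 n1 n2 => w; split.
    exact.
  move=> z [z0 Uz]; apply/derivable1_diffP; apply: differentiable_comp.
    by apply/derivable1_diffP/derivable_moebius.
  by apply/derivable1_diffP; case: gU => _; apply.
pose f x := rnorm (x - g 0).
have fc : {in [set: E], continuous f}.
  move=> x _; apply/cvgrPdist_lt => e e0; apply/nbhs_rnormP; exists e => // y yx.
  have := ler_rnorm_dist x y (g 0); have := ler_rnorm_dist y x (g 0).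
  by rewrite (rnormB x y) /f ltr_norml; lra.
have cf : convex_on setT f.
  move=> s sa _; have := sa (-1) 1 2^-1.
  rewrite !in_itv /= => /(_ ltac:(lra) ltac:(lra) ltac:(lra)).
  have -> : 2^-1 * -1 + (1 - 2^-1) * 1 = 0 :> R by field.
  have -> : 1 - 2^-1 = 2^-1 :> R by field.
  rewrite /f -half_complex -scalerDr => ->.
  have -> : 2^-1 *: (s (-1) + s 1) - g 0 = 2^-1 *: ((s (-1) - g 0) + (s 1 - g 0)).
    rewrite addrACA -opprD scalerBr; congr (_ - _).
    by rewrite -mulr2n -[g 0 *+ 2]scaler_nat scalerA mulVf ?scale1r// pnatr_eq0.
  rewrite half_complex rnormZr ger0_norm// mulrC ler_pM2r//.
  exact: ler_rnormD.
have cT : convex_set [set: E] by move=> x y l _ _; rewrite inE.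
have := convex_submean _ _ _ _ cT fc cf dV gV (fun _ _ => I).
have -> : (\int[mu]_(t in `[0%R, (2 * pi)%R]) f ((g \o moebius a) (circle_point t)) = 0)%R.
  rewrite (@eq_Rintegral _ _ _ _ _ (cst 0)); last first.
    move=> t _; rewrite /= /f.
    have [_] := rnorm_moebius a (circle_point t) a1 ltac:(by rewrite rnorm_circle_point).
    move=> /(_ (rnorm_circle_point t)) /circle_point_surj [s /gcst gs <-].
    by rewrite gs subrr rnorm0.
  by rewrite Rintegral_itv_cst ?mul0r// mulr_ge0// pi_ge0.
rewrite mulr0 /= /moebius add0r mulr0 addr0 divr1 => fa.
apply/eqP; rewrite -subr_eq0; apply/eqP/rnorm0_eq0.
by apply/eqP; rewrite eq_le fa rnorm_ge0.
Qed.

Lemma strictly_convex_submean X f U g : convex_set X -> {in X, continuous f} ->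
  strictly_convex_on X f ->
  @closed_unit_disc R `<=` U -> holomorphic_on U g -> (forall z, U z -> X (g z)) ->
  (exists z w, [/\ closed_unit_disc z, closed_unit_disc w & g z <> g w]) ->
  f (g 0) < (2 * pi)^-1 * (\int[mu]_(t in `[0%R, (2 * pi)%R]) f (g (circle_point t)))%R.
Proof.
move=> cX fc sf dU gU gX [z [w [dz dw gzw]]].
have pi0 := pi_gt0 R; have tpi0 : 0 < 2 * pi :> R by lra.
have X0 : X (g 0) by apply/gX/dU/unit_disc_rnorm; rewrite rnorm0.
have Xc t : X (g (circle_point t)) by exact/gX/dU/circle_point_disc.
(* Otherwise [g] would be constant on the circle, hence on the disc. *)
have [s s0 gs] : exists2 s : R, 0 <= s <= 2 * pi & g (circle_point s) <> g 0.
  apply: contrapT => h; apply: gzw.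
  have cst := circle_constant _ _ dU gU.
  by rewrite !cst// => t t0; apply: contrapT => gt; apply: h; exists t.
(* Averaging with [g 0] keeps the value at 0 and makes $f(k)\le\frac12(f(g)+f(g(0)))$ strict at the
   circle point of parameter [s]. *)
pose k z := 2^-1 *: (g z + g 0).
have kU : holomorphic_on U k.
  split; first by case: gU.
  move=> x Ux; apply: (@derivableZ _ _ _ (fun z => g z + g 0)).
  apply: (@derivableD _ _ _ g (fun _ => g 0)); last exact: derivable_cst.
  by case: gU => _; apply.
have kX x : U x -> X (k x) by move=> Ux; apply: midpoint_in => //; exact: gX.
have k0 : k 0 = g 0.
  by rewrite /k -mulr2n -[g 0 *+ 2]scaler_nat scalerA mulVf ?scale1r// pnatr_eq0.
have := convex_submean _ _ _ _ cX fc (proj1 sf) dU kU kX.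
rewrite k0 => /le_lt_trans.
have hc := continuous_on_circle _ _ _ _ fc dU gU gX.
have hk := continuous_on_circle _ _ _ _ fc dU kU kX.
set I := (\int[mu]_(t in _) f (g _))%R.
have ha : continuous (fun t => 2^-1 * (f (g (circle_point t)) + f (g 0))).
  move=> t; apply: cvgM; first exact: cvg_cst.
  by apply: cvgD; [exact: hc|exact: cvg_cst].
have lt1 : (\int[mu]_(t in `[0%R, (2 * pi)%R]) f (k (circle_point t)) <
    \int[mu]_(t in `[0%R, (2 * pi)%R]) (2^-1 * (f (g (circle_point t)) + f (g 0))))%R.
  apply: (lt_Rintegral_itv _ _ _ _ s hk ha tpi0) => //.
    by move=> t _; rewrite mulrC; apply: convex_on_midpoint (proj1 sf) _ _.
  by rewrite mulrC; apply: strictly_convex_on_midpoint sf _ _ _.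
have := lt1; rewrite RintegralZl//; last first.
  apply: continuous_integrable_itv => t.
  by apply: cvgD; [exact: hc|exact: cvg_cst].
rewrite RintegralD//; last 2 first.
- exact: continuous_integrable_itv hc.
- by apply: continuous_integrable_itv; exact: cst_continuous.
rewrite Rintegral_itv_cst ?(ltW tpi0)// -/I subr0 => {}lt1 H.
have : f (g 0) < (2 * pi)^-1 * (2^-1 * (I + f (g 0) * (2 * pi))).
  by apply: H; rewrite ltr_pM2l ?invr_gt0.
(* With $p=2\pi$: $f(g(0))$ is less than the average of itself and the mean of $f\circ g$, hence
   less than that mean. *)
have avg (p J v : R) : p != 0 -> p^-1 * (2^-1 * (J + v * p)) = (p^-1 * J + v) / 2.
  by move=> p0; field.
rewrite avg ?(gt_eqF tpi0)// => {}H.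
by lra.
Qed.

(** Continuity on the circle makes the extended-real integral finite, hence equal to the real
    one. *)
Lemma circle_mean_Rintegral X f U g (c : R[i]^o -> E) : {in X, continuous f} ->
  @closed_unit_disc R `<=` U -> holomorphic_on U g -> (forall z, U z -> X (g z)) ->
  (forall z, closed_unit_disc z -> g z = c z) ->
  circle_mean (EFin \o f) c =
    ((2 * pi)^-1 * (\int[mu]_(t in `[0%R, (2 * pi)%R]) f (g (circle_point t)))%R)%:E.
Proof.
move=> fc dU gU gX gc; rewrite /circle_mean EFinM; congr (_ * _)%E.
rewrite /Rintegral fineK; last first.
  apply: integrable_fin_num => //; apply: continuous_integrable_itv.
  exact: continuous_on_circle fc dU gU gX.
by apply: eq_integral => t _ /=; rewrite gc//; exact: circle_point_disc.
Qed.

End Submean.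

Theorem theorem13 (R : realType) (E : completeNormedModType R[i])
    (X : set E) (hXconvex : convex_set X) (hXopen : open X)
    (f : E -> R) (hf : {within X, continuous f}) :
  (convex_on X f -> plurisubharmonic_on X (EFin \o f)) /\
  (strictly_convex_on X f -> strictly_plurisubharmonic_on X (EFin \o f)).
Proof.
(* Openness of [X] turns continuity within [X] into continuity at each of its points. *)
have fc : {in X, continuous f} by rewrite -continuous_open_subspace.
have conv : convex_on X f -> plurisubharmonic_on X (EFin \o f).
  move=> cf; split => //.
    move=> x r Xx; rewrite lte_fin => fxr.
    (* Continuity keeps [f] below [r] on a full neighbourhood of [x], a fortiori within [X]. *)
    apply: cvg_within; have /cvgr_lt := fc x (mem_set Xx).
    by move=> /(_ _ fxr); apply: filterS => y /=; rewrite lte_fin.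
  move=> c [U [g [dU gU gX gc]]]; rewrite (circle_mean_Rintegral _ _ _ _ _ fc dU gU gX gc).
  rewrite /= -gc ?lee_fin; last by apply/unit_disc_rnorm; rewrite rnorm0.
  exact: convex_submean fc cf dU gU gX.
split=> // sf; split; first exact: conv sf.1.
move=> c [U [g [dU gU gX gc]]] [z [w [dz dw czw]]].
rewrite (circle_mean_Rintegral _ _ _ _ _ fc dU gU gX gc).
rewrite /= -gc ?lte_fin; last by apply/unit_disc_rnorm; rewrite rnorm0.
apply: strictly_convex_submean fc sf dU gU gX _ => //.
by exists z, w; rewrite !gc.
Qed.
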